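(* Let $X$ be a real Banach space such that the function $\Phi:X\to\mathbb R$, $\Phi(x):=\frac12\|x\|^2$, is Gâteaux differentiable. Let $c\ge0$. Then $$\|x+y\|^2+\|x-y\|^2\ \ge\ 2\|x\|^2+2c\|y\|^2\qquad\text{for all }x,y\in X$$ if and only if $$\|x+y\|^2\ \ge\ \|x\|^2+2D\Phi(x)[y]+c\|y\|^2\qquad\text{for all }x,y\in X .$$ The analogous equivalence holds when both inequalities are reversed: $$\|x+y\|^2+\|x-y\|^2\le2\|x\|^2+2c\|y\|^2\ \text{ for all }x,y\in X$$ if and only if $$\|x+y\|^2\le\|x\|^2+2D\Phi(x)[y]+c\|y\|^2\ \text{ for all }x,y\in X.$$ Moreover, in each case the two formulations have the same set of admissible constants $c\ge0$, and hence the same optimal coefficient.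
   Context: A function $F:X\to\mathbb R$ on a real Banach space is Gâteaux differentiable at $x$ if there is a continuous linear functional $DF(x)\in X^*$ with $DF(x)[h]=\lim_{t\to0}\frac{F(x+th)-F(x)}{t}$ for all $h\in X$; it is Gâteaux differentiable if this holds at every $x\in X$. *)

(* Defs.v *)
From HB Require Import structures.
From mathcomp Require Import all_boot all_order all_algebra.
From mathcomp Require Import all_classical all_reals all_analysis.

Set Implicit Arguments.
Unset Strict Implicit.
Unset Printing Implicit Defensive.

Import Order.TTheory GRing.Theory Num.Theory.
Import numFieldNormedType.Exports.
Local Open Scope classical_set_scope.
Local Open Scope ring_scope.

Definition is_gateaux_derivative (R : realType) (X : normedModType R)
    (F : X -> R) (x : X) (L : {linear X -> R^o}) : Prop :=
  continuous L /\
  forall h : X, (F (x + t *: h) - F x) / t @[t --> (0 : R)^'] --> L h.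

Definition gateaux_differentiable (R : realType) (X : normedModType R)
    (F : X -> R) : Prop :=
  forall x : X, exists L : {linear X -> R^o}, is_gateaux_derivative F x L.

(* The derivative is unique when it exists; as for the library's ['d f x],
   the value is unspecified when there is none. *)
Definition gateaux_derivative (R : realType) (X : normedModType R)
    (F : X -> R) (x : X) : {linear X -> R^o} :=
  get (is_gateaux_derivative F x).

Definition half_sqnorm (R : realType) (X : normedModType R) (x : X) : R :=
  2^-1 * `|x| ^+ 2.

Definition parallelogram_ge (R : realType) (X : normedModType R) (c : R)
    : Prop :=
  forall x y : X,
    `|x + y| ^+ 2 + `|x - y| ^+ 2 >= 2 * `|x| ^+ 2 + 2 * c * `|y| ^+ 2.

Definition tangent_ge (R : realType) (X : normedModType R) (c : R) : Prop :=
  forall x y : X,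
    `|x + y| ^+ 2 >=
    `|x| ^+ 2 + 2 * gateaux_derivative (@half_sqnorm R X) x y
    + c * `|y| ^+ 2.

Definition parallelogram_le (R : realType) (X : normedModType R) (c : R)
    : Prop :=
  forall x y : X,
    `|x + y| ^+ 2 + `|x - y| ^+ 2 <= 2 * `|x| ^+ 2 + 2 * c * `|y| ^+ 2.

Definition tangent_le (R : realType) (X : normedModType R) (c : R) : Prop :=
  forall x y : X,
    `|x + y| ^+ 2 <=
    `|x| ^+ 2 + 2 * gateaux_derivative (@half_sqnorm R X) x y
    + c * `|y| ^+ 2.

Definition admissible (R : realType) (P : R -> Prop) : set R :=
  [set c | 0 <= c /\ P c].

(* Extended real values, because every [c] is admissible when [X] is trivial,
   and no [c] need be admissible for the upper inequalities. *)
Definition optimal_ge (R : realType) (P : R -> Prop) : \bar R :=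
  ereal_sup [set c%:E | c in admissible P].

Definition optimal_le (R : realType) (P : R -> Prop) : \bar R :=
  ereal_inf [set c%:E | c in admissible P].

(* Main.v *)
Require Import Defs.
From HB Require Import structures.
From mathcomp Require Import all_boot all_order all_algebra.
From mathcomp Require Import all_classical all_reals all_analysis.
From mathcomp Require Import ring.
Import Order.TTheory GRing.Theory Num.Theory.
Import numFieldNormedType.Exports.
Local Open Scope classical_set_scope.
Local Open Scope ring_scope.

(** Each of the four inequalities says that a gap, left side minus right side,
    has a constant sign.  The two gaps determine one another.  In one
    direction, [DPhi(x)] is odd, so the parallelogram gap at [(x, y)] is the
    sum of the tangent gaps at [(x, y)] and [(x, - y)]
    ([parallelogram_gapE]).  In the other, the tangent gap [G t] at
    [(x, t *: y)] is [o(t)], because the derivative has been subtracted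
    ([cvg_tangent_gap_quotient]), and halving [t] changes [G t / t] by exactly
    a parallelogram gap divided by [t] ([tangent_gap_halving]).  So if the
    parallelogram gaps are nonnegative, [G t / t] decreases along
    [t = 1, 1/2, 1/4, ...] to its limit [0], and [G 1] is nonnegative
    ([halving_limit_le]).

    The argument is linear in the gaps.  Multiplying them by a factor [s] and
    taking [s = 1] or [s = -1] gives both directions of the inequality, for
    the same constant [c]; the admissible sets therefore coincide, and with
    them the optimal coefficients. *)

Section Gaps.
Context {R : realType} {X : normedModType R}.
Implicit Types (c s t : R) (x y : X).

Let D x y : R := gateaux_derivative (@half_sqnorm R X) x y.

Definition parallelogram_gap c x y : R :=
  `|x + y| ^+ 2 + `|x - y| ^+ 2 - (2 * `|x| ^+ 2 + 2 * c * `|y| ^+ 2).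

Definition tangent_gap c x y : R :=
  `|x + y| ^+ 2 - (`|x| ^+ 2 + 2 * D x y + c * `|y| ^+ 2).

(** The derivative terms cancel by oddness. *)
Lemma parallelogram_gapE c x y :
  parallelogram_gap c x y = tangent_gap c x y + tangent_gap c x (- y).
Proof. by rewrite /parallelogram_gap /tangent_gap /D linearN normrN /=; ring. Qed.

Lemma sqnormZ t y : `|t *: y| ^+ 2 = t ^+ 2 * `|y| ^+ 2.
Proof. by rewrite normrZ exprMn real_normK ?num_real. Qed.

(** The parallelogram configuration centred at [x + (t / 2) *: y] has [x] and
    [x + t *: y] as its ends, so its gap involves the same three norms; the
    derivative terms cancel by homogeneity. *)
Lemma tangent_gap_halving c x y t : t != 0 ->
  tangent_gap c x (t *: y) / t - tangent_gap c x ((t / 2) *: y) / (t / 2) =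
  parallelogram_gap c (x + (t / 2) *: y) ((t / 2) *: y) / t.
Proof.
move=> t0; rewrite /parallelogram_gap /tangent_gap /D.
rewrite -(addrA x) -scalerDl -splitr addrK !sqnormZ !linearZ /= /GRing.scale /=.
by field.
Qed.

(** Divided by [t], the gap is twice the error of the difference quotient of
    [half_sqnorm] at [x], minus [c * t * `|y| ^+ 2]. *)
Lemma cvg_tangent_gap_quotient c x y :
  gateaux_differentiable (@half_sqnorm R X) ->
  tangent_gap c x (t *: y) / t @[t --> (0 : R)^'] --> (0 : R).
Proof.
move=> hX; have [_ hD] := getPex (hX x).
have {}hD : (half_sqnorm (x + t *: y) - half_sqnorm x) / t
    @[t --> (0 : R)^'] --> D x y := hD y.
have h0 : t @[t --> (0 : R)^'] --> (0 : R) by exact: cvg_within.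
have : 2 * ((half_sqnorm (x + t *: y) - half_sqnorm x) / t - D x y)
    - c * `|y| ^+ 2 * t @[t --> (0 : R)^'] --> 2 * (D x y - D x y)
    - c * `|y| ^+ 2 * 0.
  by apply: cvgB; apply: cvgMl_tmp => //; apply: cvgB => //; exact: cvg_cst.
rewrite subrr !mulr0 subr0; apply: cvg_trans; apply: near_eq_cvg; near=> t.
have t0 : t != 0 by near: t; exact: nbhs_dnbhs_neq.
rewrite /tangent_gap /half_sqnorm /D sqnormZ !linearZ /= /GRing.scale /=.
by field.
Unshelve. all: by end_near. Qed.

End Gaps.

(** The values [f 1], [f (1/2)], [f (1/4)], ... decrease to the limit. *)
Lemma halving_limit_le {R : realType} (f : R -> R) (l : R) :
  (forall t, 0 < t -> f (t / 2) <= f t) ->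
  f t @[t --> (0 : R)^'] --> l -> l <= f 1.
Proof.
move=> f_half /cvgr_dnbhsP/(_ (fun n => 2^-1 ^+ n)) f_l.
have {}f_l : f (2^-1 ^+ n) @[n --> \oo] --> l.
  apply: f_l; split=> [n|]; first by rewrite expf_neq0.
  by apply: cvg_expr; rewrite ger0_norm ?invf_lt1 ?ltr1n.
rewrite -(cvg_lim _ f_l)//; apply: limr_le; first exact: cvgP f_l.
apply: nearW; elim=> [|n IHn]; first by rewrite expr0.
by apply: le_trans IHn; rewrite exprSr; apply: f_half; rewrite exprn_gt0.
Qed.

(** The factor [s] carries the direction of the inequality: the gaps enter only
    through sums, differences and limits, so all the arguments survive
    multiplication by a real number of either sign. *)
Lemma gap_sign_equiv {R : realType} {X : normedModType R} (c s : R) :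
  gateaux_differentiable (@half_sqnorm R X) ->
  (forall x y : X, 0 <= s * parallelogram_gap c x y) <->
  (forall x y : X, 0 <= s * tangent_gap c x y).
Proof.
move=> hX; split=> gap_ge0 x y; last first.
  by rewrite parallelogram_gapE mulrDr addr_ge0.
have := @halving_limit_le R (fun t => s * (tangent_gap c x (t *: y) / t)) 0.
rewrite scale1r divr1; apply; last first.
  rewrite -[X in _ --> X](mulr0 s); apply: cvgMl_tmp.
  exact: cvg_tangent_gap_quotient.
move=> t t_gt0; rewrite -subr_ge0 -mulrBr tangent_gap_halving ?gt_eqF//.
by rewrite mulrA divr_ge0 // ltW.
Qed.

Lemma parallelogram_ge_tangent_ge {R : realType} {X : normedModType R} (c : R) :
  gateaux_differentiable (@half_sqnorm R X) ->
  parallelogram_ge X c <-> tangent_ge X c.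
Proof.
move=> /(gap_sign_equiv c 1)[par_tan tan_par].
split=> h x y; rewrite -subr_ge0 -[leRHS]mul1r.
- by apply: par_tan => {}x {}y; rewrite mul1r subr_ge0.
- by apply: tan_par => {}x {}y; rewrite mul1r subr_ge0.
Qed.

Lemma parallelogram_le_tangent_le {R : realType} {X : normedModType R} (c : R) :
  gateaux_differentiable (@half_sqnorm R X) ->
  parallelogram_le X c <-> tangent_le X c.
Proof.
move=> /(gap_sign_equiv c (-1))[par_tan tan_par].
split=> h x y; rewrite -subr_le0 -oppr_ge0 -[leRHS]mulN1r.
- by apply: par_tan => {}x {}y; rewrite mulN1r oppr_ge0 subr_le0.
- by apply: tan_par => {}x {}y; rewrite mulN1r oppr_ge0 subr_le0.
Qed.

Lemma eq_admissible {R : realType} (P Q : R -> Prop) :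
  (forall c, P c <-> Q c) -> admissible P = admissible Q.
Proof.
by move=> PQ; apply/seteqP; split=> c [c_ge0 /PQ].
Qed.

Theorem theorem3p1 (R : realType) (X : completeNormedModType R)
    (hX : gateaux_differentiable (@half_sqnorm R X)) :
  (forall c : R, 0 <= c ->
    (parallelogram_ge X c <-> tangent_ge X c) /\
    (parallelogram_le X c <-> tangent_le X c)) /\
  (admissible (parallelogram_ge X) = admissible (tangent_ge X) /\
   optimal_ge (parallelogram_ge X) = optimal_ge (tangent_ge X)) /\
  (admissible (parallelogram_le X) = admissible (tangent_le X) /\
   optimal_le (parallelogram_le X) = optimal_le (tangent_le X)).
Proof.
have ge_equiv c := parallelogram_ge_tangent_ge c hX.
have le_equiv c := parallelogram_le_tangent_le c hX.
split=> [c _|]; first by split.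
by rewrite /optimal_ge /optimal_le (eq_admissible _ _ ge_equiv)
  (eq_admissible _ _ le_equiv).
Qed.
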